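(* Let $d,m,k\ge 1$ be integers, let $L,\beta,\gamma,\varepsilon>0$, and let $W\subseteq\mathbb{R}^d$ be a closed convex set with at least two points. Let $Z$ be a set of examples and $\ell$ a loss function such that for every $z\in Z$ the function $\ell(\cdot,z)$ is differentiable and is $\gamma$-strongly convex, $L$-Lipschitz and $\beta$-smooth on $W$. Consider the randomized algorithm (Private Strongly Convex Permutation-based SGD) which on input $S\in Z^m$ does the following: it runs $k$-pass (projected) PSGD on $S$ over $W$ with step sizes $\eta_t=\min\left(\frac1\beta,\frac1{\gamma t}\right)$, from a fixed data-independent starting point $w_0\in W$ and with a uniformly random permutation of $[m]$, obtaining the last iterate $w=w_{km}$; it sets $\Delta_2=\frac{2L}{\gamma m}$; it draws, independently of the permutation, a noise vector $\kappa\in\mathbb{R}^d$ with density $p(\kappa)\propto\exp(-\varepsilon\|\kappa\|/\Delta_2)$; and it outputs $w+\kappa$. Then this algorithm is $\varepsilon$-differentially private.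
   Context: $\|\cdot\|$ is the Euclidean norm and $[m]=\{1,\dots,m\}$. A function $f$ differentiable on an open neighborhood of $W$ is $\gamma$-strongly convex on $W$ if $f(u)\ge f(v)+\langle\nabla f(v),u-v\rangle+\frac{\gamma}{2}\|u-v\|^2$ for all $u,v\in W$; $L$-Lipschitz on $W$ if $|f(u)-f(v)|\le L\|u-v\|$ for all $u,v\in W$; $\beta$-smooth on $W$ if $\|\nabla f(u)-\nabla f(v)\|\le\beta\|u-v\|$ for all $u,v\in W$. $k$-pass projected PSGD over $W$ on $S=(z_1,\dots,z_m)\in Z^m$ with permutation $r$ of $[m]$, step sizes $\eta_1,\dots,\eta_{km}$ and starting point $w_0\in W$: for $t=1,\dots,km$ write $t=s+jm$ with $1\le s\le m$, $0\le j\le k-1$, and set $w_t=\Pi_W\big(w_{t-1}-\eta_t\nabla\ell(w_{t-1},z_{r^{-1}(s)})\big)$, where $\Pi_W$ is the Euclidean projection onto $W$ and the gradient is in the first argument. Thus the data point with index $i$ is processed exactly at steps $r(i)+jm$, $j=0,\dots,k-1$. Two datasets $S,S'\in Z^m$ are neighboring, $S\sim S'$, if they differ in a single entry. A randomized algorithm $A$ is $\varepsilon$-differentially private if $\Pr[A(S)\in E]\le e^{\varepsilon}\Pr[A(S')\in E]$ for all neighboring $S,S'$ and all (measurable) events $E$. *)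

(* Defs.v *)
(* MathComp-Analysis, over an arbitrary [R : realType]. *)
From HB Require Import structures.
From mathcomp Require Import all_boot all_order all_algebra all_fingroup.
From mathcomp Require Import all_classical all_reals all_analysis.

Set Implicit Arguments.
Unset Strict Implicit.
Unset Printing Implicit Defensive.

Import Order.TTheory GRing.Theory Num.Theory.
Import numFieldNormedType.Exports.

Local Open Scope classical_set_scope.
Local Open Scope ring_scope.

(* The library norm [`|_|] of ['rV[R]_d] is the sup norm; it induces the same
   topology and the same differentials as the Euclidean norm [norm2]. *)
Definition dotp (R : realType) d (u v : 'rV[R]_d) : R :=
  \sum_(i < d) u 0 i * v 0 i.

Definition norm2 (R : realType) d (u : 'rV[R]_d) : R := Num.sqrt (dotp u u).

Definition grad (R : realType) d (f : 'rV[R]_d -> R) (w : 'rV[R]_d) :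
  'rV[R]_d := \row_(i < d) 'D_(delta_mx 0 i) f w.

Definition differentiable_around (R : realType) d (W : set 'rV[R]_d)
    (f : 'rV[R]_d -> R) : Prop :=
  exists U : set 'rV[R]_d,
    [/\ open U, W `<=` U & forall w, U w -> differentiable f w].

Definition strongly_convex_on (R : realType) d (gamma : R) (W : set 'rV[R]_d)
    (f : 'rV[R]_d -> R) : Prop :=
  forall u v, W u -> W v ->
    f u >= f v + dotp (grad f v) (u - v) + gamma / 2 * norm2 (u - v) ^+ 2.

Definition lipschitz_on2 (R : realType) d (L : R) (W : set 'rV[R]_d)
    (f : 'rV[R]_d -> R) : Prop :=
  forall u v, W u -> W v -> `|f u - f v| <= L * norm2 (u - v).

Definition smooth_on (R : realType) d (beta : R) (W : set 'rV[R]_d)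
    (f : 'rV[R]_d -> R) : Prop :=
  forall u v, W u -> W v ->
    norm2 (grad f u - grad f v) <= beta * norm2 (u - v).

(* The default value 0 is irrelevant when [W] is nonempty, closed and convex:
   the nearest point then exists and is unique. *)
Definition proj (R : realType) d (W : set 'rV[R]_d) (x : 'rV[R]_d) :
  'rV[R]_d :=
  xget 0 [set p | W p /\ forall q, W q -> norm2 (x - p) <= norm2 (x - q)].

(* [psgd W l eta S r w0 m_gt0 t] is the t-th iterate.  The 1-based step
   [t.+1 = s + j * m], [1 <= s <= m], has 0-based position [s.-1 = t %% m]
   within its pass, and uses the example of index [r^-1 (t %% m)]. *)
Fixpoint psgd (R : realType) d (Z : Type) m (W : set 'rV[R]_d)
    (l : 'rV[R]_d -> Z -> R) (eta : nat -> R) (S : m.-tuple Z) (r : 'S_m)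
    (w0 : 'rV[R]_d) (m_gt0 : (0 < m)%N) (t : nat) : 'rV[R]_d :=
  if t is t'.+1 then
    let w := psgd W l eta S r w0 m_gt0 t' in
    let s := Ordinal (ltn_pmod t' m_gt0) in
    proj W (w - eta t'.+1 *: grad (l ^~ (tnth S ((r^-1)%g s))) w)
  else w0.

Definition neighboring (Z : Type) m (S S' : m.-tuple Z) : Prop :=
  exists i : 'I_m, tnth S i <> tnth S' i /\
    forall j : 'I_m, j != i -> tnth S j = tnth S' j.

(* A randomized algorithm is a family of random variables, one per dataset, on
   a probability space carrying its internal randomness. *)
Definition differentially_private (R : realType) dO (Omega : measurableType dO)
    (P : probability Omega R) dY (Y : measurableType dY) (Z : Type) m
    (eps : R) (A : m.-tuple Z -> {RV P >-> Y}) : Prop :=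
  forall S S' : m.-tuple Z, neighboring S S' ->
  forall E : set Y, measurable E ->
    (P (A S @^-1` E) <= (expR eps)%:E * P (A S' @^-1` E))%E.

Definition independent_RV (R : realType) dO (Omega : measurableType dO)
    (P : probability Omega R) d1 (T1 : measurableType d1)
    d2 (T2 : measurableType d2) (X : {RV P >-> T1}) (Y : {RV P >-> T2}) :
    Prop :=
  forall (A : set T1) (B : set T2), measurable A -> measurable B ->
    (P (X @^-1` A `&` Y @^-1` B) = P (X @^-1` A) * P (Y @^-1` B))%E.

Section measurable_perm.
Context (T : finType).

HB.instance Definition _ := isPointed.Build (perm_type T) 1%g.

HB.instance Definition _ :=
  @isMeasurable.Build default_measure_display (perm_type T)
    discrete_measurable (@discrete_measurable0 _)
    (@discrete_measurableC _) (@discrete_measurableU _).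

End measurable_perm.

Definition uniform_perm (R : realType) dO (Omega : measurableType dO)
    (P : probability Omega R) m (r : {RV P >-> 'S_m}) : Prop :=
  forall s : 'S_m, P (r @^-1` [set s]) = ((m`!%:R : R)^-1)%:E.

(* The sigma-algebra generated by the coordinates, as for [n.-tuple]; on
   ['rV[R]_n] it is the Borel sigma-algebra. *)
Definition measure_rV_display : measure_display -> measure_display.
Proof. exact. Qed.

Section measurable_rV.
Context {d} {T : measurableType d} (n : nat).

Let coord (i : 'I_n) (x : 'rV[T]_n) : T := x 0 i.

Let rV_set0 : g_sigma_preimage coord set0.
Proof. exact: sigma_algebra0. Qed.

Let rV_setC A : g_sigma_preimage coord A -> g_sigma_preimage coord (~` A).
Proof. exact: sigma_algebraC. Qed.

Let rV_bigcup (F : (set 'rV[T]_n)^nat) :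
  (forall i, g_sigma_preimage coord (F i)) ->
  g_sigma_preimage coord (\bigcup_i (F i)).
Proof. exact: sigma_algebra_bigcup. Qed.

HB.instance Definition _ := @isMeasurable.Build (measure_rV_display d)
  'rV[T]_n (g_sigma_preimage coord) rV_set0 rV_setC rV_bigcup.

Lemma measurable_rV_coord (i : 'I_n) :
  measurable_fun [set: 'rV[T]_n] (fun x : 'rV[T]_n => x 0 i).
Proof.
move=> _ Y mY; rewrite setTI; apply: sub_sigma_algebra => /=.
rewrite -bigcup_seq/=; exists i => /=; first by rewrite mem_index_enum.
by exists Y => //; rewrite setTI.
Qed.

Lemma measurable_fun_rVP d1 (T1 : measurableType d1) (f : T1 -> 'rV[T]_n) :
  measurable_fun [set: T1] f <->
  forall i, measurable_fun [set: T1] (fun x => f x 0 i).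
Proof.
split=> [mf i|mf].
  by apply: (@measurableT_comp _ _ _ _ _ _ (fun x : 'rV[T]_n => x 0 i));
    [exact: measurable_rV_coord|].
have mfg : g_sigma_preimage coord `<=`
    [set B | measurable (f @^-1` B)].
  apply: smallest_sub.
    split => /=.
    - by rewrite preimage_set0.
    - by move=> B mB; rewrite setTD preimage_setC; exact: measurableC.
    - by move=> F mF; rewrite preimage_bigcup; exact: bigcup_measurable.
  rewrite -bigcup_seq; apply: bigcup_sub => i _ _ [B mB <-] /=.
  by rewrite setTI -[X in measurable X]setTI; exact: mf.
by move=> _ B mB; rewrite setTI; exact: mfg.
Qed.

End measurable_rV.

Section lebesgue_rV.
Context {R : realType}.

Definition rV_cons n (p : measurableTypeR R * 'rV[R]_n) : 'rV[R]_n.+1 :=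
  \row_i (if unlift ord0 i is Some j then p.2 0 j else p.1).

Lemma rV_cons0 n (p : measurableTypeR R * 'rV[R]_n) : rV_cons p 0 ord0 = p.1.
Proof. by rewrite mxE unlift_none. Qed.

Lemma rV_consS n (p : measurableTypeR R * 'rV[R]_n) (i : 'I_n) :
  rV_cons p 0 (lift ord0 i) = p.2 0 i.
Proof. by rewrite mxE liftK. Qed.

Lemma measurable_rV_cons n :
  measurable_fun [set: measurableTypeR R * 'rV[R]_n] (@rV_cons n).
Proof.
apply/measurable_fun_rVP => i; have [->|[j ->]] : i = ord0 \/
    exists j, i = lift ord0 j.
  by case: (unliftP ord0 i) => [j ->|->]; [right; exists j|left].
- under eq_fun do rewrite rV_cons0; exact: measurable_fst.
- under eq_fun do rewrite rV_consS.
  apply: (@measurableT_comp _ _ _ _ _ _ (fun x : 'rV[R]_n => x 0 j)) => //.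
  exact: measurable_rV_coord.
Qed.

Definition rV_uncons n (x : 'rV[R]_n.+1) : measurableTypeR R * 'rV[R]_n :=
  (x 0 ord0, \row_j x 0 (lift ord0 j)).

Lemma rV_consK n : cancel (@rV_cons n) (@rV_uncons n).
Proof.
case=> a v; rewrite /rV_uncons rV_cons0; congr pair.
by apply/rowP => j; rewrite mxE rV_consS.
Qed.

Lemma rV_unconsK n : cancel (@rV_uncons n) (@rV_cons n).
Proof.
move=> x; apply/rowP => i.
by case: (unliftP ord0 i) => [j ->|->]; rewrite ?rV_consS ?rV_cons0 ?mxE.
Qed.

Lemma measurable_rV_uncons n :
  measurable_fun [set: 'rV[R]_n.+1] (@rV_uncons n).
Proof.
apply: measurable_fun_pair; first exact: measurable_rV_coord.
apply/measurable_fun_rVP => i; under eq_fun do rewrite mxE.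
exact: measurable_rV_coord.
Qed.

Section step.
Variables (n : nat) (mu : {sigma_finite_measure set 'rV[R]_n -> \bar R}).

Definition lebesgue_rV_step : set 'rV[R]_n.+1 -> \bar R :=
  pushforward (@lebesgue_measure R \x mu)%E (@rV_cons n).

HB.instance Definition _ :=
  Measure.copy lebesgue_rV_step
    (measure_function_pushforward__canonical__measure_function_Measure
      (@lebesgue_measure R \x mu)%E (@measurable_rV_cons n)).

Let lebesgue_rV_step_sigma_finite : sigma_finite setT lebesgue_rV_step.
Proof.
have /sigma_finiteP[F [TF ndF Foo]] := sigma_finiteT (@lebesgue_measure R).
have /sigma_finiteP[G [TG ndG Goo]] := sigma_finiteT mu.
exists (fun k => @rV_uncons n @^-1` (F k `*` G k)).
  apply/seteqP; split=> // x _.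
  have : [set: measurableTypeR R] (rV_uncons x).1 by [].
  have : [set: 'rV[R]_n] (rV_uncons x).2 by [].
  rewrite TF TG => -[j _ Gj] [i _ Fi]; exists (maxn i j) => //; split.
    by move: Fi; exact/subsetPset/ndF/leq_maxl.
  by move: Gj; exact/subsetPset/ndG/leq_maxr.
move=> k; have [? ?] := Foo k; have [? ?] := Goo k; split.
  rewrite -[X in measurable X]setTI; apply: measurable_rV_uncons => //.
  exact: measurableX.
rewrite /lebesgue_rV_step /pushforward -comp_preimage.
have -> : @rV_uncons n \o @rV_cons n = id.
  by apply/funext => p /=; rewrite rV_consK.
by rewrite preimage_id product_measure1E// lte_mul_pinfty// ge0_fin_numE.
Qed.

HB.instance Definition _ := Measure_isSigmaFinite.Build _ _ _
  lebesgue_rV_step lebesgue_rV_step_sigma_finite.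

End step.

(* n-dimensional Lebesgue measure, as the iterated product of the
   one-dimensional one; in dimension 0 it is the unit mass. *)
Fixpoint lebesgue_rV n : {sigma_finite_measure set 'rV[R]_n -> \bar R} :=
  match n with
  | 0 => [the {sigma_finite_measure set _ -> \bar _} of dirac (0 : 'rV[R]_0)]
  | n'.+1 => [the {sigma_finite_measure set _ -> \bar _} of
                lebesgue_rV_step (lebesgue_rV n')]
  end.

End lebesgue_rV.

Definition density_propto (R : realType) dO (Omega : measurableType dO)
    (P : probability Omega R) d (kappa : {RV P >-> 'rV[R]_d})
    (p : 'rV[R]_d -> R) : Prop :=
  exists c : R, forall B : set 'rV[R]_d, measurable B ->
    P (kappa @^-1` B) = (c%:E * \int[lebesgue_rV d]_(x in B) (p x)%:E)%E.

Definition private_psgd (R : realType) dO (Omega : measurableType dO)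
    (P : probability Omega R) d (Z : Type) m (W : set 'rV[R]_d)
    (l : 'rV[R]_d -> Z -> R) (beta gamma : R) (w0 : 'rV[R]_d)
    (m_gt0 : (0 < m)%N) (k : nat) (r : {RV P >-> 'S_m})
    (kappa : {RV P >-> 'rV[R]_d}) (S : m.-tuple Z) : Omega -> 'rV[R]_d :=
  let eta t := Num.min beta^-1 (gamma * t%:R)^-1 in
  fun omega => psgd W l eta S (r omega) w0 m_gt0 (k * m) + kappa omega.

Section measurable_private_psgd.
Context (R : realType) dO (Omega : measurableType dO) (P : probability Omega R).
Context (d m : nat) (Z : Type) (W : set 'rV[R]_d) (l : 'rV[R]_d -> Z -> R).
Context (beta gamma : R) (w0 : 'rV[R]_d) (m_gt0 : (0 < m)%N) (k : nat).
Context (r : {RV P >-> 'S_m}) (kappa : {RV P >-> 'rV[R]_d}) (S : m.-tuple Z).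

Let measurable_private_psgd :
  measurable_fun setT
    (private_psgd W l beta gamma w0 m_gt0 k r kappa S : Omega -> 'rV[R]_d).
Proof.
apply/measurable_fun_rVP => i; under eq_fun do rewrite mxE.
apply: measurable_realfun.measurable_funD.
  pose eta t := Num.min beta^-1 (gamma * t%:R)^-1.
  exact: (@measurableT_comp _ _ _ _ _ _
    (fun s : 'S_m => psgd W l eta S s w0 m_gt0 (k * m) 0 i)).
by apply: (@measurableT_comp _ _ _ _ _ _ (fun x : 'rV[R]_d => x 0 i));
  [exact: measurable_rV_coord|].
Qed.

HB.instance Definition _ := isMeasurableFun.Build _ _ _ _
  (private_psgd W l beta gamma w0 m_gt0 k r kappa S) measurable_private_psgd.

End measurable_private_psgd.

(* Main.v *)
(* Fix the permutation. With [mu = 1 - eta * gamma], the map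
   [x |-> x - eta * grad f x] satisfies [<G y - G x, p> <= mu |y - x| |p|] for
   every direction [p] between two points of [W]; only such directions survive
   the projection, so a projected step is a [mu]-contraction even though [f] is
   controlled on [W] alone and [W] may have empty interior. The differing
   example adds at most [2 * L * eta_t], once per pass, and the choice of [eta]
   gives [(1 - eta_(t+1) * gamma) * eta_t <= eta_(t+1)]; hence after [n] visits
   the iterates at time [t] are within [2 * L * n * eta_t], which is
   [2 * L / (gamma * m)] at the end. Translation invariance of Lebesgue measure
   and the triangle inequality turn this into the ratio bound for the noise, and
   the bound survives mixing over the independent permutation. *)
Require Import Defs.
From HB Require Import structures.
From mathcomp Require Import all_boot all_order all_algebra all_fingroup.
From mathcomp Require Import all_classical all_reals all_analysis.
From mathcomp Require Import measurable_realfun ring lra.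

Set Implicit Arguments.
Unset Strict Implicit.
Unset Printing Implicit Defensive.

Import Order.TTheory GRing.Theory Num.Theory.
Import numFieldNormedType.Exports.

Local Open Scope classical_set_scope.
Local Open Scope ring_scope.

(* [all_analysis] shadows [Defs.proj] by the projection of a product. *)
Local Notation proj := Defs.proj.

(** * Euclidean inner product and norm *)

Section euclidean.
Context {R : realType} {d : nat}.
Implicit Types (u v w x y p q : 'rV[R]_d) (a : R).

Lemma dotpC u v : dotp u v = dotp v u.
Proof. by apply: eq_bigr => i _; rewrite mulrC. Qed.

Lemma dotpDl u v w : dotp (u + v) w = dotp u w + dotp v w.
Proof. by rewrite -big_split; apply: eq_bigr => i _; rewrite mxE mulrDl. Qed.

Lemma dotpZl a u v : dotp (a *: u) v = a * dotp u v.
Proof. by rewrite mulr_sumr; apply: eq_bigr => i _; rewrite mxE mulrA. Qed.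

Lemma dotpNl u v : dotp (- u) v = - dotp u v.
Proof. by rewrite -scaleN1r dotpZl mulN1r. Qed.

Lemma dotpDr u v w : dotp u (v + w) = dotp u v + dotp u w.
Proof. by rewrite dotpC dotpDl !(dotpC u). Qed.

Lemma dotpZr a u v : dotp u (a *: v) = a * dotp u v.
Proof. by rewrite dotpC dotpZl dotpC. Qed.

Lemma dotpNr u v : dotp u (- v) = - dotp u v.
Proof. by rewrite dotpC dotpNl dotpC. Qed.

Lemma dotp_chasles u v w p : dotp (w - v) p + dotp (v - u) p = dotp (w - u) p.
Proof. by rewrite -dotpDl addrA subrK. Qed.

Definition dotpE := (dotpDl, dotpDr, dotpNl, dotpNr, dotpZl, dotpZr).

Lemma dotp_ge0 u : 0 <= dotp u u.
Proof. by apply: sumr_ge0 => i _; rewrite -expr2 sqr_ge0. Qed.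

Lemma dotp_eq0 u : dotp u u = 0 -> u = 0.
Proof.
move=> /eqP; rewrite psumr_eq0; last by move=> i _; rewrite -expr2 sqr_ge0.
move=> /allP u0; apply/rowP => i; rewrite mxE.
by have := u0 i; rewrite mem_index_enum => /(_ isT);
  rewrite mulf_eq0 orbb => /eqP.
Qed.

Lemma norm2_ge0 u : 0 <= norm2 u.
Proof. exact: sqrtr_ge0. Qed.

Lemma sqr_norm2 u : norm2 u ^+ 2 = dotp u u.
Proof. by rewrite sqr_sqrtr// dotp_ge0. Qed.

Lemma norm2_eq0 u : norm2 u = 0 -> u = 0.
Proof. by move=> u0; apply: dotp_eq0; rewrite -sqr_norm2 u0 expr0n. Qed.

Lemma dotp0l u : dotp 0 u = 0.
Proof. by rewrite -(scale0r u) dotpZl mul0r. Qed.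

Lemma norm20 : norm2 (0 : 'rV[R]_d) = 0.
Proof. by rewrite /norm2 dotp0l sqrtr0. Qed.

Lemma norm2Z a u : norm2 (a *: u) = `|a| * norm2 u.
Proof. by rewrite /norm2 dotpZl dotpZr mulrA -expr2 sqrtrM ?sqr_ge0// sqrtr_sqr. Qed.

Lemma norm2N u : norm2 (- u) = norm2 u.
Proof. by rewrite -scaleN1r norm2Z normrN1 mul1r. Qed.

Lemma norm2B u v : norm2 (u - v) = norm2 (v - u).
Proof. by rewrite -norm2N opprB. Qed.

Lemma cauchy_schwarz u v : dotp u v <= norm2 u * norm2 v.
Proof.
have [u0|u0] := eqVneq (norm2 u) 0.
  by rewrite (norm2_eq0 u0) dotp0l norm20 mul0r.
have [v0|v0] := eqVneq (norm2 v) 0.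
  by rewrite (norm2_eq0 v0) dotpC dotp0l norm20 mulr0.
have uv : 0 < norm2 u * norm2 v by rewrite mulr_gt0// lt0r ?u0 ?v0 norm2_ge0.
have := dotp_ge0 (norm2 v *: u - norm2 u *: v).
rewrite !dotpE (dotpC v u) -!sqr_norm2 => h.
by rewrite -(ler_pM2l uv); lra.
Qed.

Lemma ler_norm2D u v : norm2 (u + v) <= norm2 u + norm2 v.
Proof.
rewrite -(@ler_pXn2r _ 2)// ?nnegrE ?addr_ge0 ?norm2_ge0//.
rewrite sqrrD !sqr_norm2 !dotpE (dotpC v u) -!sqr_norm2.
by have := cauchy_schwarz u v; lra.
Qed.

Lemma continuous_norm2 : continuous (@norm2 R d).
Proof.
move=> x; apply: (@continuous_comp _ _ _ (fun u => dotp u u)); last exact: sqrt_continuous.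
apply: (continuous_big (P := xpredT)) => [|i _ y]; first exact: add_continuous.
by apply: continuousM; exact: coord_continuous.
Qed.

(** Compactness is tested in the sup norm, so this carries Euclidean bounds over to it. *)
Lemma normr_le_norm2 u : `|u| <= norm2 u.
Proof.
rewrite /Num.norm/= mx_normrE; apply/bigmax_leP; split; first exact: norm2_ge0.
move=> [i j] _ /=; rewrite ord1 -sqrtr_sqr ler_sqrt ?dotp_ge0//.
by rewrite /dotp (bigD1 j)//= expr2 lerDl sumr_ge0// => k _; rewrite -expr2 sqr_ge0.
Qed.

End euclidean.

(** * Limits along powers of two *)

Lemma exp2_ge (R : realType) (x : R) : exists n, x <= 2 ^+ n.
Proof.
exists (Num.bound `|x|).
have /ltW /(le_trans (ler_norm x)) := archi_boundP (normr_ge0 x).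
move=> /le_trans; apply; rewrite -natrX ler_nat; exact/ltnW/ltn_expl.
Qed.

(** Stands in for a limit: the error [c / 2 ^+ n] falls below any positive amount. *)
Lemma le_of_halving (R : realType) (a b c : R) :
  (forall n, a <= b + c / 2 ^+ n) -> a <= b.
Proof.
move=> h; apply/ler_addgt0Pr => e e0; have [n cn] := exp2_ge (c / e).
rewrite (le_trans (h n))// lerD2l ler_pdivrMr ?exprn_gt0//.
by rewrite mulrC -ler_pdivrMr.
Qed.

Definition convex_comb_closed (R : realType) d (W : set 'rV[R]_d) :=
  forall (x y : 'rV[R]_d) (t : R), W x -> W y -> 0 <= t <= 1 ->
  W (t *: x + (1 - t) *: y).

Lemma convex_set_comb (R : realType) d (W : set 'rV[R]_d) :
  convex_set W -> convex_comb_closed W.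
Proof.
move=> cW x y t Wx Wy /andP[t0 t1].
have /set_mem := cW x y (Itv01 t0 t1) (mem_set Wx) (mem_set Wy).
by [].
Qed.

(** * Nearest-point projection onto a closed convex set *)

Section projection.
Context {R : realType} {d : nat} {W : set 'rV[R]_d}.
Hypotheses (W_closed : closed W) (W_convex : convex_comb_closed W).

Lemma proj_nearest (x w : 'rV[R]_d) : W w ->
  W (proj W x) /\ forall q, W q -> norm2 (x - proj W x) <= norm2 (x - q).
Proof.
move=> Ww; rewrite /proj; case: xgetP => [p -> //|no]; exfalso.
(* Only points of [W] no farther from [x] than [w] compete for the minimum; they form a compact set,
   on which a minimiser exists by continuity. *)
pose B := W `&` [set q | norm2 (x - q) <= norm2 (x - w)].
have contx : continuous (fun q : 'rV[R]_d => norm2 (x - q)).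
  move=> q; apply: (@continuous_comp _ _ _ (fun q : 'rV[R]_d => x - q)).
    by apply: (@cvgB _ _ _ (nbhs q) _ (fun=> x) id); [exact: cvg_cst|exact: cvg_id].
  exact: continuous_norm2.
have cB : compact B.
  apply: bounded_closed_compact.
    exists (norm2 (x - w) + `|x|); split; first exact: num_real.
    move=> M hM q [_ /= hq]; apply/ltW/(le_lt_trans _ hM).
    rewrite -[q](subKr x) (le_trans (ler_normB _ _))// addrC lerD2r.
    exact: (le_trans (normr_le_norm2 _)).
  apply: closedI => //.
  apply: (@preimage_closed _ _ _ [set r | r <= _]) => //.
have [p /set_mem[Wp _] pmin] := @EVT_min_rV R d (fun q => norm2 (x - q)) B
  (ex_intro _ w (conj Ww (lexx _))) cB (continuous_subspaceT contx).
apply: (no p); split=> // q Wq.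
have [qw|wq] := leP (norm2 (x - q)) (norm2 (x - w)).
  by apply: pmin; rewrite inE; split.
by rewrite (le_trans _ (ltW wq))//; apply: pmin; rewrite inE; split=> /=.
Qed.

Lemma proj_in (x w : 'rV[R]_d) : W w -> W (proj W x).
Proof. by move=> /(@proj_nearest x)[]. Qed.

(** Moving from the projection towards [q] by [t = 2^-n] cannot reduce the squared distance to [x];
    dividing by [t] leaves an error of order [t]. *)
Lemma proj_variational (x q : 'rV[R]_d) : W q ->
  dotp (x - proj W x) (q - proj W x) <= 0.
Proof.
move=> Wq; have [Wp pmin] := @proj_nearest x q Wq; set p := proj W x in Wp pmin *.
apply: (@le_of_halving _ _ _ (dotp (q - p) (q - p))) => n.
set t := (2 ^+ n)^-1; have t0 : 0 < t by rewrite invr_gt0 exprn_gt0.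
have t1 : t <= 1 by rewrite invf_le1 ?exprn_gt0// exprn_ege1// ler1n.
have := pmin _ (W_convex Wq Wp (t := t) _); rewrite (ltW t0) t1 => /(_ isT).
rewrite -(@ler_pXn2r _ 2)// ?nnegrE ?norm2_ge0// !sqr_norm2.
have -> : x - (t *: q + (1 - t) *: p) = (x - p) - t *: (q - p).
  by rewrite scalerBl scalerBr scale1r; apply/rowP => i; rewrite !mxE; ring.
move: (x - p) (q - p) => u v; rewrite !dotpE (dotpC v u) => h.
have tv : 0 <= t * (t * dotp v v) by rewrite !mulr_ge0 ?dotp_ge0// ltW.
rewrite add0r mulrC -(ler_pM2l t0); lra.
Qed.

(** Sum of the variational inequalities at the two projections, each tested at the other. *)
Lemma proj_firmly_nonexpansive (a b w : 'rV[R]_d) : W w ->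
  norm2 (proj W a - proj W b) ^+ 2 <= dotp (a - b) (proj W a - proj W b).
Proof.
move=> Ww; have := proj_variational a (proj_in b Ww).
have := proj_variational b (proj_in a Ww).
rewrite sqr_norm2; move: (proj W a) (proj W b) => p q; rewrite !dotpE.
rewrite (dotpC q p); lra.
Qed.

End projection.

(** * Projected gradient step for a strongly convex smooth loss *)

Section gradient_step.
Context {R : realType} {d : nat} {W : set 'rV[R]_d} {f : 'rV[R]_d -> R}.
Context {beta gamma : R}.
Hypothesis gamma_ge0 : 0 <= gamma.
Hypotheses (W_convex : convex_comb_closed W).
Hypotheses (f_sc : strongly_convex_on gamma W f) (f_smooth : smooth_on beta W f).

Lemma convex_midpoint (x y : 'rV[R]_d) : W x -> W y -> W (2^-1 *: (x + y)).
Proof.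
move=> Wx Wy; have := W_convex Wx Wy (t := 2^-1) _.
have -> : 1 - 2^-1 = 2^-1 :> R by lra.
by rewrite -scalerDr; apply; apply/andP; split; lra.
Qed.

(* Halving the segment halves the excess of the constant over beta / 2, so no
   integration along the segment is needed. *)
Lemma descent_lemma (x y : 'rV[R]_d) : W x -> W y ->
  f y <= f x + dotp (grad f x) (y - x) + beta / 2 * norm2 (y - x) ^+ 2.
Proof.
move=> Wx Wy.
suff halving n u v : W u -> W v -> f v <= f u + dotp (grad f u) (v - u) +
    beta / 2 * norm2 (v - u) ^+ 2 + beta / 2 * norm2 (v - u) ^+ 2 / 2 ^+ n.
  by apply: le_of_halving => n; exact: halving.
have cross u1 u2 e : W u1 -> W u2 ->
    dotp (grad f u1 - grad f u2) e <= beta * norm2 (u1 - u2) * norm2 e.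
  move=> W1 W2; apply: (le_trans (cauchy_schwarz _ _)).
  by apply: ler_wpM2r; [exact: norm2_ge0|exact: f_smooth].
elim: n u v => [|n IHn] u v Wu Wv.
  (* Base case with constant [beta]: strong convexity at [v] bounds [f v] through [grad f v], and
     smoothness exchanges this for [grad f u]. *)
  have := cross v u (v - u) Wv Wu; have := f_sc Wu Wv.
  rewrite (norm2B u v) expr0 divr1.
  have -> : u - v = - (v - u) by rewrite opprB.
  have : 0 <= gamma / 2 * norm2 (v - u) ^+ 2.
    by rewrite mulr_ge0 ?sqr_ge0// divr_ge0.
  rewrite !dotpE; lra.
have Wz := convex_midpoint Wu Wv.
set z := 2^-1 *: (u + v) in Wz.
have zu : z - u = 2^-1 *: (v - u).
  by apply/rowP => i; rewrite !mxE; field.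
have vz : v - z = 2^-1 *: (v - u).
  by apply/rowP => i; rewrite !mxE; field.
have := IHn _ _ Wu Wz; have := IHn _ _ Wz Wv.
have := cross z u (2^-1 *: (v - u)) Wz Wu.
rewrite !zu !vz !norm2Z ger0_norm; last by lra.
rewrite !dotpE (exprS 2 n) invfM; move: (2 ^+ n)^-1 => c; lra.
Qed.

Let step eta (u : 'rV[R]_d) := u - eta *: grad f u.

(* The quadratic upper bound given by strong convexity at [x] (resp. [y]) is
   compared at [x + w] (resp. [y - w]) with the lower bound given by the
   descent lemma at [y] (resp. [x]). *)
Lemma gradient_step_local eta (x y w : 'rV[R]_d) :
  0 <= eta -> eta * beta <= 1 -> W x -> W y -> W (x + w) -> W (y - w) ->
  2 * dotp (step eta y - step eta x) w <=
  (1 - eta * gamma) * (norm2 (y - x) ^+ 2 + norm2 w ^+ 2).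
Proof.
move=> eta0 etab Wx Wy Wxw Wyw.
have yxE : step eta y - step eta x =
    (y - x) - eta *: (grad f y - grad f x).
  by rewrite /step scalerBr; apply/rowP => i; rewrite !mxE; ring.
have e1 : x + w - x = w by rewrite addrC addKr.
have e2 : x + w - y = w - (y - x) by apply/rowP => i; rewrite !mxE; ring.
have e3 : y - w - y = - w by rewrite addrC addKr.
have e4 : y - w - x = (y - x) - w by rewrite addrAC.
have e5 : x - y = - (y - x) by rewrite opprB.
have := f_sc Wxw Wx; rewrite e1.
have := descent_lemma Wy Wxw; rewrite e2.
have := f_sc Wyw Wy; rewrite e3.
have := descent_lemma Wx Wyw; rewrite e4.
have := f_sc Wx Wy; rewrite e5.
have := f_sc Wy Wx.
rewrite yxE; move: (y - x) (grad f x) (grad f y) => e gx gy.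
rewrite (norm2B w e) !norm2N => A B C D E F.
(* [le1] is strong monotonicity of the gradient and [le2] adds the two comparisons; [le3] raises
   [eta * beta] to 1 in front of [norm2 (e - w) ^+ 2], whose cross term supplies [dotp e w]. *)
have le1 : 0 <= eta * (dotp gy e - dotp gx e - gamma * norm2 e ^+ 2).
  by apply: mulr_ge0 => //; move: A B; rewrite !dotpE; lra.
have le2 : 0 <= eta * (2 * (dotp gy w - dotp gx w) - (dotp gy e - dotp gx e) +
    beta * norm2 (e - w) ^+ 2 - gamma * norm2 w ^+ 2).
  by apply: mulr_ge0 => //; move: C D E F; rewrite !dotpE; lra.
have le3 : 0 <= (1 - eta * beta) * norm2 (e - w) ^+ 2.
  by rewrite mulr_ge0 ?sqr_ge0// subr_ge0.
move: le1 le2 le3; rewrite !sqr_norm2 !dotpE (dotpC w e); lra.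
Qed.

(** The bound is additive along a segment and convexity keeps the room at midpoints, so the segment
    is halved until [norm2 (y - x) <= tau * norm2 p], where the local bound applies. *)
Lemma gradient_step_interior eta tau (p x y : 'rV[R]_d) :
  0 <= eta -> eta * beta <= 1 -> 0 < tau ->
  (forall t, `|t| <= tau -> W (x + t *: p)) ->
  (forall t, `|t| <= tau -> W (y + t *: p)) ->
  dotp (step eta y - step eta x) p <=
  (1 - eta * gamma) * norm2 (y - x) * norm2 p.
Proof.
move=> eta0 etab tau0.
have [p0|p0] := eqVneq (norm2 p) 0.
  by rewrite p0 (norm2_eq0 p0) dotpC dotp0l mulr0.
have {}p0 : 0 < norm2 p by rewrite lt0r p0 norm2_ge0.
have [n] := exp2_ge (norm2 (y - x) / (tau * norm2 p)).
rewrite ler_pdivrMr ?mulr_gt0//.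
elim: n x y => [|n IHn] x y; last first.
  move=> xyn Kx Ky.
  have [z zE] : exists z, z = 2^-1 *: (x + y) by eexists.
  have zx : z - x = 2^-1 *: (y - x).
    by rewrite zE; apply/rowP => i; rewrite !mxE; field.
  have yz : y - z = 2^-1 *: (y - x).
    by rewrite zE; apply/rowP => i; rewrite !mxE; field.
  have Kz t : `|t| <= tau -> W (z + t *: p).
    move=> tt; have := convex_midpoint (Kx t tt) (Ky t tt).
    by rewrite zE; congr W; apply/rowP => i; rewrite !mxE; field.
  have nE : norm2 (2^-1 *: (y - x)) = 2^-1 * norm2 (y - x).
    by rewrite norm2Z ger0_norm// invr_ge0.
  have zn : 2^-1 * norm2 (y - x) <= 2 ^+ n * (tau * norm2 p).
    by move: xyn; rewrite exprS -mulrA; lra.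
  have := IHn x z; rewrite zx nE => /(_ zn Kx Kz) hx.
  have := IHn z y; rewrite yz nE => /(_ zn Kz Ky) hy.
  have := lerD hy hx; rewrite dotp_chasles => /le_trans; apply.
  by rewrite le_eqVlt; apply/orP; left; apply/eqP; field.
rewrite expr0 mul1r => xyp Kx Ky; set e := norm2 (y - x).
have [e0|e0] := eqVneq e 0.
  have /eqP := norm2_eq0 e0; rewrite subr_eq0 => /eqP ->.
  by rewrite subrr dotp0l e0 mulr0 mul0r.
have {}e0 : 0 < e by rewrite lt0r e0 norm2_ge0.
(* Scaling [p] to the length of [y - x] keeps the displacement within the room and makes the two
   squares in the local bound equal. *)
have tt : `|e / norm2 p| <= tau.
  by rewrite (ger0_norm (divr_ge0 (ltW e0) (ltW p0))) ler_pdivrMr.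
have Wx : W x by rewrite -[x]addr0 -(scale0r p); apply: Kx; rewrite normr0 ltW.
have Wy : W y by rewrite -[y]addr0 -(scale0r p); apply: Ky; rewrite normr0 ltW.
have Wy' : W (y - (e / norm2 p) *: p).
  by rewrite -scaleNr; apply: Ky; rewrite normrN.
have := gradient_step_local eta0 etab Wx Wy (Kx _ tt) Wy'.
rewrite -/e norm2Z (ger0_norm (divr_ge0 (ltW e0) (ltW p0))) divfK ?gt_eqF//.
rewrite dotpZr; set D := dotp _ p => h.
rewrite -(ler_pM2l (divr_gt0 e0 p0)).
have -> : e / norm2 p * ((1 - eta * gamma) * e * norm2 p) =
  (1 - eta * gamma) * e ^+ 2 by field; rewrite gt_eqF.
lra.
Qed.

(* A point of [W] pulled by a factor [s] towards the midpoint of [q1] and [q2]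
   has room of size [s / 2] on both sides in the direction [q1 - q2]; this
   replaces the relative interior of [W]. *)
Lemma pulled_room s t (u q1 q2 : 'rV[R]_d) :
  0 < s <= 1 -> `|t| <= s / 2 -> W u -> W q1 -> W q2 ->
  W (u + s *: (2^-1 *: (q1 + q2) - u) + t *: (q1 - q2)).
Proof.
move=> /andP[s0 s1] ts Wu W1 W2.
have ts' : `|t / s| <= 2^-1.
  by rewrite normrM normfV (gtr0_norm s0) ler_pdivrMr// mulrC.
have Wc : W ((2^-1 + t / s) *: q1 + (1 - (2^-1 + t / s)) *: q2).
  by apply: W_convex => //; move: ts'; rewrite ler_norml => /andP[]; lra.
have := W_convex Wc Wu (t := s); rewrite (ltW s0) s1 => /(_ isT).
congr W; apply/rowP => i; rewrite !mxE; field; exact: lt0r_neq0.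
Qed.

Lemma grad_pulled s (u c p : 'rV[R]_d) : 0 <= s ->
  W u -> W (u + s *: (c - u)) ->
  dotp (grad f u) p <=
  dotp (grad f (u + s *: (c - u))) p + s * (beta * norm2 (c - u) * norm2 p).
Proof.
move=> s0 Wu Wus; have := cauchy_schwarz (grad f u - grad f (u + s *: (c - u))) p.
have := f_smooth Wu Wus; rewrite opprD addNKr norm2N norm2Z ger0_norm// => h1 h2.
have := ler_wpM2r (norm2_ge0 p) h1.
move: h2; rewrite dotpDl dotpNl; lra.
Qed.

(** Pulling [u] and [v] towards [c] gives them the room needed by [gradient_step_interior]; undoing
    the pull costs terms linear in [s], from the shrunken difference and from the change of
    gradients. *)
Lemma gradient_step_pulled s eta (u v p c : 'rV[R]_d) :
  0 < s <= 1 -> 0 <= eta -> eta * beta <= 1 -> eta * gamma <= 1 ->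
  W u -> W v ->
  (forall t, `|t| <= s / 2 -> W (u + s *: (c - u) + t *: p)) ->
  (forall t, `|t| <= s / 2 -> W (v + s *: (c - v) + t *: p)) ->
  dotp (step eta v - step eta u) p <=
  (1 - eta * gamma) * norm2 (v - u) * norm2 p +
  ((norm2 (v - u) + eta * beta * (norm2 (c - u) + norm2 (c - v))) * norm2 p) * s.
Proof.
move=> /andP[s0 s1] eta0 etab etag Wu Wv Kus Kvs.
set us := u + _ in Kus; set vs := v + _ in Kvs.
have s20 : 0 < s / 2 by rewrite divr_gt0.
have := gradient_step_interior eta0 etab s20 Kus Kvs.
have Wus : W us by rewrite -[us]addr0 -(scale0r p); apply: Kus; rewrite normr0 ltW.
have Wvs : W vs by rewrite -[vs]addr0 -(scale0r p); apply: Kvs; rewrite normr0 ltW.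
have vus : vs - us = (v - u) - s *: (v - u).
  by apply/rowP => i; rewrite !mxE; ring.
have -> : norm2 (vs - us) = (1 - s) * norm2 (v - u).
  by rewrite vus -{1}[v - u]scale1r -scalerBl norm2Z ger0_norm// subr_ge0.
move=> h.
have hu : 0 <= eta * (dotp (grad f us) p +
    s * (beta * norm2 (c - u) * norm2 p) - dotp (grad f u) p).
  by rewrite mulr_ge0// subr_ge0; apply: grad_pulled => //; exact: ltW.
have hv : 0 <= eta * (dotp (grad f vs) (- p) +
    s * (beta * norm2 (c - v) * norm2 p) - dotp (grad f v) (- p)).
  rewrite mulr_ge0// subr_ge0 -[in leRHS](norm2N p).
  by apply: grad_pulled => //; exact: ltW.
have hs := cauchy_schwarz (s *: (v - u)) p.
have hm : 0 <= s * ((1 - eta * gamma) * norm2 (v - u) * norm2 p).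
  by rewrite !mulr_ge0 ?norm2_ge0 ?subr_ge0// ltW.
have stepB a b : dotp (step eta b - step eta a) p =
    dotp (b - a) p - eta * dotp (grad f b) p + eta * dotp (grad f a) p.
  rewrite /step !dotpE; ring.
rewrite (stepB u v); move: h; rewrite (stepB us vs).
have -> : dotp (vs - us) p = dotp (v - u) p - s * dotp (v - u) p.
  by rewrite vus dotpDl dotpNl dotpZl.
move: hs; rewrite norm2Z (gtr0_norm s0) dotpZl.
move: hv hm; rewrite dotpNr dotpNr.
move: (dotp (grad f us) p) (dotp (grad f vs) p) hu => A B hu.
lra.
Qed.

(** With the midpoint of [q1] and [q2] as [c] and [s = 2^-n], the pulling error vanishes in the
    limit. *)
Lemma gradient_step_contraction_dir eta (u v q1 q2 : 'rV[R]_d) :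
  0 <= eta -> eta * beta <= 1 -> eta * gamma <= 1 ->
  W u -> W v -> W q1 -> W q2 ->
  dotp (step eta v - step eta u) (q1 - q2) <=
  (1 - eta * gamma) * norm2 (v - u) * norm2 (q1 - q2).
Proof.
move=> eta0 etab etag Wu Wv W1 W2.
apply: le_of_halving => n.
have s01 : 0 < (2 ^+ n : R)^-1 <= 1.
  by rewrite invr_gt0 exprn_gt0// invf_le1 ?exprn_gt0// exprn_ege1// ler1n.
by apply: (gradient_step_pulled (c := 2^-1 *: (q1 + q2))) => // t ts;
  exact: pulled_room.
Qed.

(** The full gradient may exceed [L] in norm, since [f] is Lipschitz only on [W]. From a pulled
    point, a move by [s / 2] along [q1 - q2] stays in [W], where strong convexity and the Lipschitz
    bound control the slope; then [s] tends to 0. *)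
Lemma grad_dir_le L (w q1 q2 : 'rV[R]_d) : lipschitz_on2 L W f ->
  W w -> W q1 -> W q2 ->
  dotp (grad f w) (q1 - q2) <= L * norm2 (q1 - q2).
Proof.
move=> f_lip Ww W1 W2; pose c := 2^-1 *: (q1 + q2).
apply: (@le_of_halving _ _ _ (beta * norm2 (c - w) * norm2 (q1 - q2))) => n.
have : 0 < (2 ^+ n : R)^-1 <= 1.
  by rewrite invr_gt0 exprn_gt0// invf_le1 ?exprn_gt0// exprn_ege1// ler1n.
move: (2 ^+ n)^-1 => s s01; have /andP[s0 s1] := s01.
have K t : `|t| <= s / 2 -> W (w + s *: (c - w) + t *: (q1 - q2)).
  by move=> ts; exact: pulled_room.
have Wws : W (w + s *: (c - w)).
  by rewrite -[X in W X]addr0 -(scale0r (q1 - q2)); apply: K;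
    rewrite normr0 ltW// divr_gt0.
have Wws' : W (w + s *: (c - w) + (s / 2) *: (q1 - q2)).
  by apply: K; rewrite gtr0_norm// divr_gt0.
have := grad_pulled (q1 - q2) (ltW s0) Ww Wws.
have dirE (x y : 'rV[R]_d) : x + y - x = y by rewrite addrC addKr.
have := f_sc Wws' Wws; have := le_trans (ler_norm _) (f_lip _ _ Wws' Wws).
rewrite dirE norm2Z gtr0_norm ?divr_gt0// dotpZr.
move: (dotp _ (q1 - q2)) => D h1 h2 h3.
have h4 : 0 <= gamma / 2 * (s / 2 * norm2 (q1 - q2)) ^+ 2.
  by rewrite mulr_ge0 ?sqr_ge0// divr_ge0.
have : s / 2 * D <= s / 2 * (L * norm2 (q1 - q2)) by lra.
rewrite ler_pM2l ?divr_gt0//; lra.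
Qed.

(** Strong convexity in both directions bounds the gradient difference along [u - v] from below,
    smoothness from above. This later yields [eta * gamma <= 1]. *)
Lemma sc_le_smooth : (exists u v, [/\ W u, W v & u <> v]) -> gamma <= beta.
Proof.
move=> [u [v [Wu Wv uv]]].
have n0 : 0 < norm2 (u - v).
  rewrite lt0r norm2_ge0 andbT; apply/eqP => /norm2_eq0/eqP.
  by rewrite subr_eq0 => /eqP.
rewrite -(ler_pM2r (exprn_gt0 2 n0)).
have := cauchy_schwarz (grad f u - grad f v) (u - v).
have := ler_wpM2r (ltW n0) (f_smooth Wu Wv).
have := f_sc Wu Wv; have := f_sc Wv Wu.
rewrite (norm2B v u) -(opprB u v) dotpNr [dotp (_ - _) _]dotpDl dotpNl; lra.
Qed.

Hypothesis W_closed : closed W.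

(** Firm nonexpansiveness tests the step difference against the difference of the projections, a
    direction between points of [W]; one factor of its norm then cancels. *)
Lemma proj_gradient_step eta (u v : 'rV[R]_d) :
  0 <= eta -> eta * beta <= 1 -> eta * gamma <= 1 -> W u -> W v ->
  norm2 (proj W (u - eta *: grad f u) - proj W (v - eta *: grad f v)) <=
  (1 - eta * gamma) * norm2 (u - v).
Proof.
move=> eta0 etab etag Wu Wv; set a := u - _ *: _; set b := v - _ *: _.
have := proj_firmly_nonexpansive W_closed W_convex a b Wu.
have Wa := proj_in W_closed a Wu; have Wb := proj_in W_closed b Wu.
have := gradient_step_contraction_dir eta0 etab etag Wv Wu Wa Wb.
rewrite -/a -/b; set n := norm2 (_ - proj W b) => h /le_trans/(_ h).
have := norm2_ge0 (proj W a - proj W b); rewrite -/n le_eqVlt => /orP[/eqP<-|n0].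
  by rewrite mulr_ge0 ?norm2_ge0// subr_ge0.
by rewrite expr2 ler_pM2r.
Qed.

End gradient_step.

(** Same cancellation from one point with two losses: each gradient contributes at most [L] along
    the projected difference. *)
Lemma proj_gradient_step_diff (R : realType) d (W : set 'rV[R]_d)
    (f g : 'rV[R]_d -> R) (beta gamma L eta : R) (v : 'rV[R]_d) :
  0 <= gamma -> closed W -> convex_comb_closed W ->
  strongly_convex_on gamma W f -> smooth_on beta W f -> lipschitz_on2 L W f ->
  strongly_convex_on gamma W g -> smooth_on beta W g -> lipschitz_on2 L W g ->
  0 <= eta -> 0 <= L -> W v ->
  norm2 (proj W (v - eta *: grad f v) - proj W (v - eta *: grad g v)) <=
  2 * L * eta.
Proof.
move=> g0 cW vW fsc fsm fL gsc gsm gL eta0 L0 Wv.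
set a := v - _ *: grad f _; set b := v - _ *: grad g _.
have abE : a - b = eta *: (grad g v - grad f v).
  by rewrite /a /b scalerBr; apply/rowP => i; rewrite !mxE; ring.
clearbody a b; have := proj_firmly_nonexpansive cW vW a b Wv.
have Wa := proj_in cW a Wv; have Wb := proj_in cW b Wv.
move: (proj W a) (proj W b) Wa Wb => p1 p2 W1 W2; rewrite abE {a b abE}.
have := grad_dir_le g0 vW fsc fsm fL Wv W2 W1.
have := grad_dir_le g0 vW gsc gsm gL Wv W1 W2.
rewrite (norm2B p2 p1) -(opprB p1 p2) dotpNr.
move: (p1 - p2) (grad f v) (grad g v) => p gf gg hg hf; rewrite dotpZl => h.
have {}h : norm2 p ^+ 2 <= eta * (2 * L * norm2 p).
  apply: (le_trans h); apply: ler_wpM2l => //; rewrite dotpDl dotpNl; lra.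
move: h; move: (norm2 p) (norm2_ge0 p) => n n0 h.
move: n0; rewrite le_eqVlt => /orP[/eqP<-|n0]; first by rewrite !mulr_ge0.
by rewrite -(ler_pM2r n0) -expr2 (le_trans h)// mulrCA mulrA.
Qed.

(** * Stability of the iterates under a change of one example *)

Section stability.
Context {R : realType} {d m : nat} {L beta gamma : R}.
Hypotheses (L_gt0 : 0 < L) (beta_gt0 : 0 < beta) (gamma_gt0 : 0 < gamma).
Hypothesis gamma_le_beta : gamma <= beta.
Context {W : set 'rV[R]_d}.
Hypotheses (W_closed : closed W) (W_convex : convex_comb_closed W).
Context {Z : Type} {l : 'rV[R]_d -> Z -> R}.
Hypothesis l_sc : forall z, strongly_convex_on gamma W (l ^~ z).
Hypothesis l_lip : forall z, lipschitz_on2 L W (l ^~ z).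
Hypothesis l_smooth : forall z, smooth_on beta W (l ^~ z).
Context {w0 : 'rV[R]_d} {m_gt0 : (0 < m)%N}.
Hypothesis w0W : W w0.

Let eta t : R := Num.min beta^-1 (gamma * t%:R)^-1.

Lemma psgd_in (S : m.-tuple Z) r t : W (psgd W l eta S r w0 m_gt0 t).
Proof. by case: t => [//|t]; exact: (proj_in W_closed _ w0W). Qed.

Let eta_ge0 t : 0 <= eta t.
Proof.
by rewrite /eta le_min !invr_ge0 (ltW beta_gt0) mulr_ge0// ltW.
Qed.

Let eta_beta t : eta t * beta <= 1.
Proof. by rewrite -ler_pdivlMr// mul1r /eta ge_min lexx. Qed.

Let eta_gamma t : eta t * gamma <= 1.
Proof. by apply: le_trans (eta_beta t); exact: ler_wpM2l. Qed.

(** While [eta t.+1] is [beta^-1], the factor is at most 1 and [eta t] is at most [beta^-1];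
    afterwards the factor is [t / (t + 1)], which turns [(gamma * t)^-1] into
    [(gamma * (t + 1))^-1]. *)
Let eta_contract t : (1 - eta t.+1 * gamma) * eta t <= eta t.+1.
Proof.
have [->|t0] := eqVneq t 0%N.
  (* Inversion sends 0 to 0, so [eta 0 = 0]. *)
  by rewrite {2}/eta mulr0 invr0 min_r ?mulr0// invr_ge0 ltW.
have tp : 0 < t%:R :> R by rewrite ltr0n lt0n.
have [h|h] := leP beta^-1 (gamma * t.+1%:R)^-1.
  have -> : eta t.+1 = beta^-1 by rewrite /eta min_l.
  have : eta t <= beta^-1 by rewrite /eta ge_min lexx.
  move=> /(fun h => ler_pM _ (eta_ge0 t) _ h) H.
  rewrite -[leRHS]mul1r; apply: H.
    by rewrite subr_ge0 mulrC ler_pdivrMr// mul1r.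
  by rewrite gerBl mulr_ge0// ?invr_ge0 ltW.
have -> : eta t.+1 = (gamma * t.+1%:R)^-1 by rewrite /eta min_r ?ltW.
have e1 : 1 - (gamma * t.+1%:R)^-1 * gamma = t%:R / t.+1%:R :> R.
  rewrite -natr1; field; rewrite gt_eqF//=; rewrite gt_eqF// addr_gt0//.
rewrite e1 (@le_trans _ _ (t%:R / t.+1%:R * (gamma * t%:R)^-1))//.
  by rewrite ler_wpM2l ?divr_ge0// /eta ge_min lexx orbT.
rewrite le_eqVlt; apply/orP; left; apply/eqP; rewrite -natr1; field.
by rewrite !gt_eqF// addr_gt0.
Qed.

(** The sum counts the steps so far that process the differing example, whose 0-based position in
    each pass is [r i]. *)
Lemma psgd_stability (S S' : m.-tuple Z) (i : 'I_m) (r : 'S_m) t :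
  (forall j, j != i -> tnth S j = tnth S' j) ->
  norm2 (psgd W l eta S r w0 m_gt0 t - psgd W l eta S' r w0 m_gt0 t) <=
  2 * L * (\sum_(s < t) (s %% m == r i))%N%:R * eta t.
Proof.
move=> SS'; elim: t => [|t IHt].
  by rewrite /= subrr norm20 big_ord0 mulr0 mul0r.
rewrite big_ord_recr/=.
set w := psgd W l eta S r w0 m_gt0 t in IHt *.
set w' := psgd W l eta S' r w0 m_gt0 t in IHt *.
have Ww : W w by exact: psgd_in.
have Ww' : W w' by exact: psgd_in.
set s := Ordinal _; set z := tnth S _; set z' := tnth S' _; set e := eta t.+1.
have contr := proj_gradient_step (ltW gamma_gt0) W_convex (l_sc z) (l_smooth z) W_closed
  (eta_ge0 t.+1) (eta_beta t.+1) (eta_gamma t.+1) Ww Ww'.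
have ee := eta_contract t.
set N := (\sum_(s < t) _)%N in IHt *.
have bound : norm2 (proj W (w - e *: grad (l^~ z) w) -
    proj W (w' - e *: grad (l^~ z) w')) <= 2 * L * N%:R * e.
  apply: (le_trans contr).
  apply: (@le_trans _ _ ((1 - e * gamma) * (2 * L * N%:R * eta t))).
    by rewrite ler_wpM2l// subr_ge0 eta_gamma.
  by rewrite mulrCA ler_wpM2l// !mulr_ge0// ltW.
have [si|si] := eqVneq (t %% m)%N (r i : nat); last first.
  rewrite addn0.
  (* Away from position [r i] the processed index is not [i], so both runs use the same example. *)
  have -> // : z' = z.
  rewrite /z' /z SS'//; apply: contraNneq si => ri.
  by rewrite -ri permKV.
rewrite addn1 -[N.+1%:R]natr1 mulrDr mulr1 mulrDl.
(* The inserted point steps from [w'] with the example of [S]: the first gap has one loss and two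
   starting points, the second one starting point and two losses. *)
rewrite -[X in norm2 X](subrKA (proj W (w' - e *: grad (l^~ z) w'))).
apply: (le_trans (ler_norm2D _ _)); apply: lerD => //.
by apply: (proj_gradient_step_diff (ltW gamma_gt0)) => //; [exact: eta_ge0|exact: ltW].
Qed.

Lemma visits_count (s : 'I_m) k : (\sum_(t < k * m) (t %% m == s))%N = k.
Proof.
elim: k => [|k IHk]; first by rewrite big_ord0.
rewrite mulSn addnC big_split_ord/= IHk (bigD1 s)//= big1 ?addn0.
  by rewrite modnMDl modn_small// eqxx addn1.
by move=> j js; rewrite modnMDl modn_small// -val_eqE in js *; rewrite (negbTE js).
Qed.

Lemma psgd_sensitivity (S S' : m.-tuple Z) (r : 'S_m) k :
  (0 < k)%N -> neighboring S S' ->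
  norm2 (psgd W l eta S r w0 m_gt0 (k * m) - psgd W l eta S' r w0 m_gt0 (k * m))
  <= 2 * L / (gamma * m%:R).
Proof.
move=> k0 [i [_ SS']]; apply: (le_trans (psgd_stability _ _ SS')).
rewrite visits_count -mulrA ler_wpM2l//; first by rewrite mulr_ge0// ltW.
(* The last step size is at most [(gamma * (k * m))^-1], whose factor [k] cancels the number of
   visits. *)
apply: (@le_trans _ _ (k%:R * (gamma * (k * m)%:R)^-1)).
  by rewrite ler_wpM2l// /eta ge_min lexx orbT.
rewrite le_eqVlt; apply/orP; left; apply/eqP; rewrite natrM; field.
by rewrite (gt_eqF gamma_gt0) !pnatr_eq0 -!lt0n m_gt0 k0.
Qed.

End stability.

(** * Translation invariance of Lebesgue measure *)

Section translation_invariance.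
Context {R : realType}.
Local Notation mu := (@lebesgue_measure R).

Lemma measurable_shift (a : R) :
  measurable_fun [set: measurableTypeR R]
    ((fun x => x + a) : measurableTypeR R -> measurableTypeR R).
Proof. exact: measurable_funD. Qed.

(** The pushforward has the right value on half-open intervals, and uniqueness does the rest. *)
Lemma lebesgue_measure_shift (a : R) (A : set (measurableTypeR R)) :
  measurable A ->
  mu A = pushforward mu ((fun x => x + a) : _ -> measurableTypeR R) A.
Proof.
have := @lebesgue_measure_unique R
  (measure_function_pushforward__canonical__measure_function_Measure
     mu (measurable_shift a)).
apply => _ [[b c]] _ <-.
transitivity (mu `]b - a, c - a]%classic).
  rewrite !lebesgue_measure_itv/= !lte_fin ltrD2r -!EFinB.
  by congr (if _ then _%:E else _); ring.
congr (mu _).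
by apply/seteqP; split=> x /=; rewrite !in_itv/= ltrBlDr lerBrDr.
Qed.

Lemma ge0_integral_shift (a : R) (f : R -> \bar R) :
  measurable_fun [set: R] f -> (forall x, 0 <= f x)%E ->
  (\int[mu]_x f (x + a)%R = \int[mu]_x f x)%E.
Proof.
move=> mf f0; have := ge0_integral_pushforward (measurable_shift a) mu
  measurableT mf (fun x _ => f0 x).
rewrite preimage_setT => /esym/= ->.
apply: eq_measure_integral => [|? A mA _]; first exact: measurable_shift.
exact: esym (lebesgue_measure_shift a mA).
Qed.

Lemma measurable_rV_shift n (v : 'rV[R]_n) :
  measurable_fun [set: 'rV[R]_n] (fun x => x + v).
Proof.
apply/measurable_fun_rVP => i; under eq_fun do rewrite mxE.
apply: measurable_funD => //; exact: measurable_rV_coord.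
Qed.

Lemma measurable_rV_shift_preimage n (v : 'rV[R]_n) (E : set 'rV[R]_n) :
  measurable E -> measurable ((fun x : 'rV[R]_n => v + x) @^-1` E).
Proof.
move=> mE; rewrite -[X in measurable X]setTI; under eq_fun do rewrite addrC.
exact: measurable_rV_shift.
Qed.

(** Tonelli peels off the first coordinate; the induction hypothesis shifts the others, and
    one-dimensional invariance shifts the first. *)
Lemma ge0_integral_rV_shift n (v : 'rV[R]_n) (f : 'rV[R]_n -> \bar R) :
  measurable_fun setT f -> (forall x, 0 <= f x)%E ->
  (\int[lebesgue_rV n]_x f (x + v)%R = \int[lebesgue_rV n]_x f x)%E.
Proof.
elim: n v f => [|n IHn] v f mf f0.
  by apply: eq_integral => x _; congr f; apply/rowP => -[].
have mfc : measurable_fun setT (f \o @rV_cons R n).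
  exact: measurableT_comp mf (@measurable_rV_cons R n).
have mfv : measurable_fun [set: 'rV[R]_n.+1] (fun x : 'rV[R]_n.+1 => f (x + v)).
  exact: measurableT_comp mf (measurable_rV_shift v).
have mfvc : measurable_fun setT ((fun x : 'rV[R]_n.+1 => f (x + v)) \o @rV_cons R n).
  exact: measurableT_comp mfv (@measurable_rV_cons R n).
have pushE g : measurable_fun setT g -> (forall x, 0 <= g x)%E ->
    (\int[lebesgue_rV n.+1]_x g x =
     \int[mu \x lebesgue_rV n]_p (g \o @rV_cons R n) p)%E.
  move=> mg g0.
  exact: (ge0_integral_pushforward (@measurable_rV_cons R n) _ measurableT mg).
rewrite !pushE//.
rewrite !fubini_tonelli1//; last 2 first.
- by move=> p; exact: f0.
- by move=> p; exact: f0.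
rewrite /fubini_F /=.
pose F (x : measurableTypeR R) : \bar R :=
  (\int[lebesgue_rV n]_y f (rV_cons (x, y)))%E.
transitivity (\int[mu]_x F (x + v 0 ord0)%R)%E.
  apply: eq_integral => x _.
  transitivity (\int[lebesgue_rV n]_y
      f (rV_cons ((x + v 0%R ord0)%R : measurableTypeR R,
                  (y + \row_j v 0 (lift ord0 j))%R)))%E.
    apply: eq_integral => y _; congr f; apply/rowP => i; rewrite mxE.
    by case: (unliftP ord0 i) => [j ->|->]; rewrite ?rV_consS ?rV_cons0 ?mxE.
  apply: (IHn _ (fun y => f (rV_cons (x + v 0 ord0 : measurableTypeR R, y)))) => //.
  exact: (measurableT_comp mfc (measurable_pair1 _)).
apply: ge0_integral_shift.
  exact: (measurable_fun_fubini_tonelli_F _ mfc (fun p => f0 (rV_cons p))).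
by move=> x; exact: integral_ge0.
Qed.

End translation_invariance.

(** * Privacy of the noise and mixing over permutations *)

Section norm_mechanism.
Context {R : realType} {d : nat}.
Local Notation lambda := (@lebesgue_rV R d).

Lemma measurable_norm2 : measurable_fun [set: 'rV[R]_d] (@norm2 R d).
Proof.
apply: (@measurableT_comp _ _ _ _ _ _ (@Num.sqrt R) _ (fun x => dotp x x)).
  by apply: continuous_measurable_fun; exact: sqrt_continuous.
apply: measurable_sum => i.
by apply: measurable_funM; exact: measurable_rV_coord.
Qed.

(** Translation by [w - w'] matches the two events; pointwise, the triangle inequality changes the
    exponent by at most [a * norm2 (w - w')]. *)
Lemma integral_expR_norm2_shift (a eps : R) (w w' : 'rV[R]_d) (E : set 'rV[R]_d) :
  0 <= a -> a * norm2 (w - w') <= eps -> measurable E ->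
  (\int[lambda]_(x in (fun x => w + x)%R @^-1` E) (expR (- (a * norm2 x)))%:E <=
   (expR eps)%:E *
   \int[lambda]_(x in (fun x => w' + x)%R @^-1` E) (expR (- (a * norm2 x)))%:E)%E.
Proof.
move=> a0 ww' mE; pose p (x : 'rV[R]_d) := (expR (- (a * norm2 x)))%:E.
have mp : measurable_fun setT p.
  apply/measurable_EFinP/measurableT_comp => //; apply: measurableT_comp => //.
  by apply: measurable_funM => //; exact: measurable_norm2.
have mEw u := measurable_rV_shift_preimage u mE.
(* Extending the integrands by zero moves the events into the functions, so invariance over the
   whole space applies. *)
rewrite [leLHS]integral_mkcond [X in (_ <= _ * X)%E]integral_mkcond.
set q := _ \_ _; set q' := _ \_ ((fun x => w' + x) @^-1` E).
have mq : measurable_fun setT q.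
  by apply/(measurable_restrictT _ _).1 => //; exact: measurable_funTS.
have mq' : measurable_fun setT q'.
  by apply/(measurable_restrictT _ _).1 => //; exact: measurable_funTS.
have q0 x : (0 <= q x)%E by apply: erestrict_ge0 => y _; rewrite lee_fin expR_ge0.
have q'0 x : (0 <= q' x)%E by apply: erestrict_ge0 => y _; rewrite lee_fin expR_ge0.
rewrite -(ge0_integral_rV_shift (w - w') mq' q'0).
have mq's : measurable_fun [set: 'rV[R]_d] (fun x : 'rV[R]_d => q' (x + (w - w'))).
  exact: measurableT_comp mq' (measurable_rV_shift (w - w')).
rewrite -ge0_integralZl//.
apply: ge0_le_integral => //.
- exact: measurable_funeM.
move=> x _; rewrite /q /q' !patchE.
have shiftE : (w' + (x + (w - w')))%R = (w + x)%R.
  by apply/rowP => i; rewrite !mxE; ring.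
have -> : (x + (w - w') \in (fun x => w' + x) @^-1` E) =
          (x \in (fun x => w + x) @^-1` E).
  by apply/idP/idP; rewrite !in_setE/= shiftE.
case: ifPn => _; last by rewrite mule0.
rewrite /p -EFinM lee_fin -expRD ler_expR.
by have := ler_wpM2l a0 (ler_norm2D x (w - w')); lra.
Qed.

End norm_mechanism.

(** Independence splits both probabilities into finite sums over permutations with the same weights,
    so the bound transfers term by term. *)
Lemma dp_mixture (R : realType) dO (Omega : measurableType dO)
    (P : probability Omega R) d m (r : {RV P >-> 'S_m})
    (kappa : {RV P >-> 'rV[R]_d}) (w w' : 'S_m -> 'rV[R]_d) (c : R)
    (E : set 'rV[R]_d) :
  independent_RV r kappa -> measurable E ->
  (forall s, P (kappa @^-1` ((fun x => w s + x)%R @^-1` E)) <=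
     c%:E * P (kappa @^-1` ((fun x => w' s + x)%R @^-1` E)))%E ->
  (P ((fun o => w (r o) + kappa o)%R @^-1` E) <=
     c%:E * P ((fun o => w' (r o) + kappa o)%R @^-1` E))%E.
Proof.
move=> indep mE H.
have mEu u := measurable_rV_shift_preimage u mE.
have split_perm (u : 'S_m -> 'rV[R]_d) : (P ((fun o => u (r o) + kappa o)%R @^-1` E) =
    \sum_(s \in [set: 'S_m])
      P (r @^-1` [set s]) * P (kappa @^-1` ((fun x => u s + x)%R @^-1` E)))%E.
  under eq_fsbigr do rewrite -indep//.
  rewrite -measure_fin_bigcup//.
  - congr (P _); apply/seteqP; split=> o /=.
      by move=> Eo; exists (r o).
    by move=> [s _] /= [->].
  - exact: finite_finset.
  - by move=> s s' _ _ [x [/= [+ _] [+ _]]] => <- <-.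
  - move=> s _; apply: measurableI.
      by rewrite -[X in measurable X]setTI; exact: measurable_funP.
    by rewrite -[X in measurable X]setTI; exact: measurable_funP.
rewrite !split_perm ge0_mule_fsumr; last by move=> s; rewrite mule_ge0.
apply: lee_fsum => [|s _]; first exact: finite_finset.
by rewrite muleCA; apply: lee_wpmul2l.
Qed.

Theorem theorem5 (R : realType) (d m k : nat)
  (d_gt0 : (0 < d)%N) (m_gt0 : (0 < m)%N) (k_gt0 : (0 < k)%N)
  (L beta gamma eps : R)
  (L_gt0 : 0 < L) (beta_gt0 : 0 < beta) (gamma_gt0 : 0 < gamma)
  (eps_gt0 : 0 < eps)
  (W : set 'rV[R]_d) (W_closed : closed W) (W_convex : convex_set W)
  (W_two_points : exists u v, [/\ W u, W v & u <> v])
  (Z : Type) (l : 'rV[R]_d -> Z -> R)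
  (l_hyp : forall z, [/\ differentiable_around W (l ^~ z),
                         strongly_convex_on gamma W (l ^~ z),
                         lipschitz_on2 L W (l ^~ z) &
                         smooth_on beta W (l ^~ z)])
  (w0 : 'rV[R]_d) (w0W : W w0)
  (dO : measure_display) (Omega : measurableType dO) (P : probability Omega R)
  (r : {RV P >-> 'S_m}) (r_uniform : uniform_perm r)
  (kappa : {RV P >-> 'rV[R]_d})
  (kappa_density : let Delta2 := 2 * L / (gamma * m%:R) in
    density_propto kappa (fun x => expR (- (eps * norm2 x / Delta2))))
  (r_kappa_indep : independent_RV r kappa) :
  differentially_private eps
    (fun S : m.-tuple Z =>
       private_psgd W l beta gamma w0 m_gt0 k r kappa S : {RV P >-> 'rV[R]_d}).
Proof.
move=> S S' SS' E mE.
have W_cc := convex_set_comb W_convex.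
have l_sc z : strongly_convex_on gamma W (l ^~ z) by case: (l_hyp z).
have l_lip z : lipschitz_on2 L W (l ^~ z) by case: (l_hyp z).
have l_smooth z : smooth_on beta W (l ^~ z) by case: (l_hyp z).
(* Neighboring datasets have an index, hence an example whose loss relates the two constants. *)
have gb : gamma <= beta.
  case: SS' => i _.
  exact: sc_le_smooth (l_sc (tnth S i)) (l_smooth (tnth S i)) W_two_points.
have D0 : 0 < 2 * L / (gamma * m%:R).
  by rewrite divr_gt0 ?mulr_gt0// ltr0n.
pose eta t := Num.min beta^-1 (gamma * t%:R)^-1.
apply: (dp_mixture (w := fun s => psgd W l eta S s w0 m_gt0 (k * m))
  (w' := fun s => psgd W l eta S' s w0 m_gt0 (k * m)) r_kappa_indep mE) => s.
have sens := psgd_sensitivity L_gt0 beta_gt0 gamma_gt0 gb W_closed W_cc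
  l_sc l_lip l_smooth w0W (m_gt0 := m_gt0) s k_gt0 SS'.
have mEu q := measurable_rV_shift_preimage q mE.
have [c cP] := kappa_density; rewrite !cP//.
(* [density_propto] leaves the sign of [c] open; total mass 1 against a nonnegative integral
   excludes [c < 0]. *)
have c_ge0 : 0 <= c.
  rewrite leNgt; apply/negP => c0.
  have := cP setT measurableT; rewrite preimage_setT probability_setT => h.
  have : ((1 : R)%:E <= 0)%E.
    rewrite h; apply: mule_le0_ge0; first by rewrite lee_fin ltW.
    by apply: integral_ge0 => x _; rewrite lee_fin expR_ge0.
  by rewrite lee_fin ler10.
rewrite muleCA; apply: lee_wpmul2l; first by rewrite lee_fin.
have normE x : eps * norm2 x / (2 * L / (gamma * m%:R)) =
    eps / (2 * L / (gamma * m%:R)) * norm2 (x : 'rV[R]_d) by rewrite mulrAC.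
under eq_integral do rewrite normE.
under [X in (_ <= _ * X)%E]eq_integral do rewrite normE.
apply: integral_expR_norm2_shift => //.
  by rewrite divr_ge0// ltW.
by rewrite mulrAC ler_pdivrMr// ler_wpM2l// ltW.
Qed.
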